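(* Let $X$ be a $W$-hyperbolic space, $C\subseteq X$ a nonempty convex subset, and $T,U:C\to C$ nonexpansive mappings with $Fix(T)\cap Fix(U)\neq\emptyset$. Let $x_0,u\in C$, let $\alpha_n=\frac{2}{n+2}$ and $\beta_n=\beta\in(0,1)$ for all $n\in\mathbb N$, and let $(x_n),(y_n)$ be the alternating Halpern-Mann iteration: for all $n\in\mathbb N$, $y_n=(1-\alpha_n)Tx_n+\alpha_n u$ and $x_{n+1}=(1-\beta_n)Uy_n+\beta_n y_n$. Let $p\in Fix(T)\cap Fix(U)$, $M_p=\max\{d(x_0,p),d(u,p)\}$, and let $K\in\mathbb N$, $K\geq1$, satisfy $K\geq M_p$. Then for all $n\in\mathbb N$, $$d(x_n,x_{n+1})\leq\frac{4K}{n+2}\quad\text{and}\quad d(y_n,y_{n+1})\leq\frac{4K}{n+3}.$$ Thus $(x_n)$ is asymptotically regular with rate $\Sigma_1(k)=4K(k+1)-2$ and $(y_n)$ is asymptotically regular with rate $\Sigma_2(k)=4K(k+1)-3$.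
   Context: $\mathbb N=\{0,1,2,\dots\}$. A $W$-hyperbolic space is a metric space $(X,d)$ with a function $W:X\times X\times[0,1]\to X$, where $(1-\lambda)x+\lambda y$ denotes $W(x,y,\lambda)$, such that for all $x,y,w,z\in X$ and $\lambda,\tilde\lambda\in[0,1]$: (W1) $d(z,(1-\lambda)x+\lambda y)\le(1-\lambda)d(z,x)+\lambda d(z,y)$; (W2) $d((1-\lambda)x+\lambda y,(1-\tilde\lambda)x+\tilde\lambda y)=|\lambda-\tilde\lambda|d(x,y)$; (W3) $(1-\lambda)x+\lambda y=\lambda y+(1-\lambda)x$, i.e. $W(x,y,\lambda)=W(y,x,1-\lambda)$; (W4) $d((1-\lambda)x+\lambda z,(1-\lambda)y+\lambda w)\le(1-\lambda)d(x,y)+\lambda d(z,w)$. A nonempty $C\subseteq X$ is convex if $(1-\lambda)x+\lambda y\in C$ for all $x,y\in C$, $\lambda\in[0,1]$. A mapping $S:C\to C$ is nonexpansive if $d(Sx,Sy)\le d(x,y)$ for all $x,y\in C$; $Fix(S)$ is its set of fixed points. A sequence $(z_n)$ is asymptotically regular with rate $\varphi:\mathbb N\to\mathbb N$ if $d(z_n,z_{n+1})\le\frac1{k+1}$ for all $k\in\mathbb N$ and all $n\geq\varphi(k)$. *)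

(* Defs.v *)
From mathcomp Require Import all_boot all_order all_algebra.
From mathcomp Require Import all_classical all_reals topology.

Set Implicit Arguments.
Unset Strict Implicit.
Unset Printing Implicit Defensive.

Import Order.TTheory GRing.Theory Num.Theory.

Local Open Scope classical_set_scope.
Local Open Scope ring_scope.

(* [W x y l] stands for the formal combination (1 - l) x + l y: the weight [l]
   is that of the second point.  [W] takes any scalar, but its values are only
   constrained, and only used, for weights in [0, 1].  The library's [convType]
   does not apply, since its combinations are required to be associative. *)
Record W_hyperbolic (R : realType) (X : metricType R) (W : X -> X -> R -> X) :
    Prop := {
  W1 : forall (x y z : X) (l : R), 0 <= l <= 1 ->
    mdist z (W x y l) <= (1 - l) * mdist z x + l * mdist z y ;
  W2 : forall (x y : X) (l m : R), 0 <= l <= 1 -> 0 <= m <= 1 ->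
    mdist (W x y l) (W x y m) = `|l - m| * mdist x y ;
  W3 : forall (x y : X) (l : R), 0 <= l <= 1 ->
    W x y l = W y x (1 - l) ;
  W4 : forall (x y z w : X) (l : R), 0 <= l <= 1 ->
    mdist (W x z l) (W y w l) <= (1 - l) * mdist x y + l * mdist z w
}.

Definition W_convex (R : realType) (X : metricType R) (W : X -> X -> R -> X)
    (C : set X) : Prop :=
  forall (x y : X) (l : R), C x -> C y -> 0 <= l <= 1 -> C (W x y l).

(* A mapping C -> C is represented by a function on X that maps C into C; its
   values outside C are irrelevant. *)
Definition nonexpansive (R : realType) (X : metricType R) (C : set X)
    (S : X -> X) : Prop :=
  set_fun C C S /\
  forall x y : X, C x -> C y -> mdist (S x) (S y) <= mdist x y.

Definition Fix (X : Type) (C : set X) (S : X -> X) : set X :=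
  [set x | C x /\ S x = x].

Definition alternating_Halpern_Mann (R : realType) (X : metricType R)
    (W : X -> X -> R -> X) (T U : X -> X) (x0 u : X) (alpha beta : nat -> R)
    (x y : nat -> X) : Prop :=
  [/\ x 0%N = x0,
      forall n, y n = W (T (x n)) u (alpha n) &
      forall n, x n.+1 = W (U (y n)) (y n) (beta n)].

Definition asymptotically_regular_with_rate (R : realType) (X : metricType R)
    (z : nat -> X) (phi : nat -> nat) : Prop :=
  forall k n : nat, (phi k <= n)%N ->
    mdist (z n) (z n.+1) <= 1 / (k%:R + 1).

(* Main.v *)
Require Import Defs.
From mathcomp Require Import all_boot all_order all_algebra.
From mathcomp Require Import all_classical all_reals topology.
From mathcomp Require Import ring lra zify.

Import Order.TTheory GRing.Theory Num.Theory.

Local Open Scope classical_set_scope.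
Local Open Scope ring_scope.

(** Every term of both sequences stays in the ball of radius [K] around [p].
    Since [beta] is constant, (W4) gives
    [d (x (n+1)) (x (n+2)) <= d (y n) (y (n+1))], while (W4) and (W2) give
    [d (y n) (y (n+1)) <= (n+1)/(n+3) * d (x n) (x (n+1)) + 4K/((n+2)(n+3))].
    The bound [4K/(n+2)] on [d (x n) (x (n+1))] turns the right-hand side into
    exactly [4K/(n+3)], so it propagates by induction. *)

Lemma W_ball {R : realType} {X : metricType R} {W : X -> X -> R -> X}
    {p a b : X} {l r : R} :
  W_hyperbolic W -> 0 <= l <= 1 ->
  mdist p a <= r -> mdist p b <= r -> mdist p (W a b l) <= r.
Proof.
move=> hW hl ha hb; have hWab := W1 hW a b p hl.
case/andP: hl => l0 l1; nra.
Qed.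

(** The triangle inequality through [W a c m] separates the two changes: moving the weight from [l]
    to [m] is measured by (W2), and moving the first point from [a] to [b] by (W4), where the common
    point [c] contributes nothing. *)
Lemma mdist_W_same {R : realType} {X : metricType R} {W : X -> X -> R -> X}
    (a b c : X) {l m : R} :
  W_hyperbolic W -> 0 <= l <= 1 -> 0 <= m <= 1 ->
  mdist (W a c l) (W b c m) <= (1 - m) * mdist a b + `|l - m| * mdist a c.
Proof.
move=> hW hl hm; rewrite addrC.
apply: (le_trans (metric_triangle _ (W a c m) _)); apply: lerD.
  by rewrite (W2 hW).
by apply: (le_trans (W4 hW _ _ _ _ hm)); rewrite mdistxx mulr0 addr0.
Qed.

(** With equal weights, (W4) bounds the left side by an average of [mdist (U a) (U b)] and
    [mdist a b]. *)
Lemma mdist_relax_le {R : realType} {X : metricType R} {W : X -> X -> R -> X}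
    {C : set X} {U : X -> X} {a b : X} {l : R} :
  W_hyperbolic W -> nonexpansive C U -> C a -> C b -> 0 <= l <= 1 ->
  mdist (W (U a) a l) (W (U b) b l) <= mdist a b.
Proof.
move=> hW [_ hU] Ca Cb hl; apply: (le_trans (W4 hW _ _ _ _ hl)).
have := hU a b Ca Cb; case/andP: hl => l0 l1; nra.
Qed.

Lemma nonexpansive_ball {R : realType} {X : metricType R} {C : set X}
    {S : X -> X} {p a : X} {r : R} :
  nonexpansive C S -> Fix C S p -> C a -> mdist p a <= r -> mdist p (S a) <= r.
Proof.
by move=> [_ hS] [Cp Sp] Ca; apply: le_trans; rewrite -{1}Sp; exact: hS.
Qed.

Lemma div_rate {R : realType} {c j n k : nat} :
  (0 < j)%N -> (c * (k + 1) - j <= n)%N ->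
  c%:R / (n%:R + j%:R) <= 1 / (k%:R + 1) :> R.
Proof.
(* This also holds when the natural-number subtraction truncates to 0. *)
move=> j0 hn; have {hn} : (c * (k + 1) <= n + j)%N by lia.
rewrite -(ler_nat R) natrM !natrD => h.
have k1 : 0 < k%:R + 1 :> R by rewrite ltr_wpDl.
have nj : 0 < n%:R + j%:R :> R by rewrite ltr_wpDl // ltr0n.
by rewrite (ler_pdivrMr _ _ nj) mulrAC mul1r (ler_pdivlMr _ _ k1).
Qed.

Theorem proposition3p4 (R : realType) (X : metricType R)
    (W : X -> X -> R -> X) (hW : W_hyperbolic W)
    (C : set X) (C0 : C !=set0) (hC : W_convex W C)
    (T U : X -> X) (hT : nonexpansive C T) (hU : nonexpansive C U)
    (hTU : Fix C T `&` Fix C U !=set0)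
    (x0 u : X) (hx0 : C x0) (hu : C u)
    (beta : R) (hbeta : 0 < beta < 1)
    (x y : nat -> X)
    (hxy : alternating_Halpern_Mann W T U x0 u
             (fun n : nat => 2 / (n%:R + 2)) (fun _ : nat => beta) x y)
    (p : X) (hp : (Fix C T `&` Fix C U) p)
    (K : nat) (hK1 : (1 <= K)%N)
    (hK : Num.max (mdist x0 p) (mdist u p) <= K%:R) :
  (forall n : nat,
      mdist (x n) (x n.+1) <= 4 * K%:R / (n%:R + 2) /\
      mdist (y n) (y n.+1) <= 4 * K%:R / (n%:R + 3)) /\
  asymptotically_regular_with_rate x
    (fun k : nat => (4 * K * (k + 1) - 2)%N) /\
  asymptotically_regular_with_rate y
    (fun k : nat => (4 * K * (k + 1) - 3)%N).
Proof.
have [hx00 hy hx] := hxy; have [hpT hpU] := hp.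
have hb : 0 <= beta <= 1 by case/andP: hbeta => /ltW -> /ltW ->.
have ha n : 0 <= 2 / (n%:R + 2 : R) <= 1.
  have n0 : 0 <= n%:R :> R by rewrite ler0n.
  by rewrite divr_ge0 ?ler_pdivrMr; lra.
have [hx0K huK] : mdist p x0 <= K%:R /\ mdist p u <= K%:R.
  by move: hK; rewrite ge_max ![mdist p _]metric_sym => /andP[].
have Cstep n : C (x n) -> C (y n).
  by move=> Cx; rewrite hy; apply: hC => //; exact: hT.1.
have Cx n : C (x n).
  elim: n => [|n IHn]; first by rewrite hx00.
  by rewrite hx; apply: hC => //; [apply: hU.1|]; exact: Cstep.
have Cy n : C (y n) by exact: Cstep.
have Bstep n : mdist p (x n) <= K%:R -> mdist p (y n) <= K%:R.
  move=> Bx; rewrite hy; apply: W_ball => //; exact: (nonexpansive_ball hT hpT (Cx n) Bx).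
have Bx n : mdist p (x n) <= K%:R.
  elim: n => [|n /Bstep IHn]; first by rewrite hx00.
  by rewrite hx; apply: W_ball => //; exact: (nonexpansive_ball hU hpU (Cy n) IHn).
have x_le_y n : mdist (x n.+1) (x n.+2) <= mdist (y n) (y n.+1).
  by rewrite (hx n) (hx n.+1); exact: (mdist_relax_le hW hU).
(* The bound on [x] is kept as a premise because this implication drives the induction for
   [x_le]. *)
have y_le_x n : mdist (x n) (x n.+1) <= 4 * K%:R / (n%:R + 2) ->
    mdist (y n) (y n.+1) <= 4 * K%:R / (n%:R + 3).
  move=> hn; rewrite (hy n) (hy n.+1).
  apply: (le_trans (mdist_W_same _ _ _ hW (ha n) (ha n.+1))).
  have hTx : mdist (T (x n)) (T (x n.+1)) <= 4 * K%:R / (n%:R + 2).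
    by apply: le_trans hn; exact: hT.2.
  (* Both points lie in the ball of radius [K] around [p]. *)
  have hTu : mdist (T (x n)) u <= 2 * K%:R.
    apply: (le_trans (metric_triangle _ p _)).
    have : mdist p (T (x n)) <= K%:R.
      exact: (nonexpansive_ball hT hpT (Cx n) (Bx n)).
    rewrite metric_sym; lra.
  have n0 : 0 <= n%:R :> R by rewrite ler0n.
  have -> : n.+1%:R = n%:R + 1 :> R by rewrite natr1.
  have -> : 1 - 2 / (n%:R + 1 + 2) = (n%:R + 1) / (n%:R + 3) :> R.
    by field; lra.
  have -> : 2 / (n%:R + 2) - 2 / (n%:R + 1 + 2)
      = 2 / ((n%:R + 2) * (n%:R + 3)) :> R by field; lra.
  (* The target is split to match the two terms of [mdist_W_same]; after factoring out
     4K/((n+2)(n+3)), the identity is (n+1) + 1 = n+2. *)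
  have -> : 4 * K%:R / (n%:R + 3)
      = (n%:R + 1) / (n%:R + 3) * (4 * K%:R / (n%:R + 2))
        + 2 / ((n%:R + 2) * (n%:R + 3)) * (2 * K%:R) :> R by field; lra.
  rewrite ger0_norm; last by rewrite divr_ge0 ?mulr_ge0; lra.
  by apply: lerD; apply: ler_wpM2l => //; rewrite divr_ge0 ?mulr_ge0; lra.
have x_le n : mdist (x n) (x n.+1) <= 4 * K%:R / (n%:R + 2).
  elim: n => [|n /y_le_x IHn].
    apply: (le_trans (metric_triangle _ p _)).
    (* At n = 0 the bound is 2K, the sum of the distances of [x 0] and [x 1] to [p], each at most
       [K]. *)
    have -> : 4 * K%:R / (0%:R + 2) = K%:R + K%:R :> R by field.
    by apply: lerD; rewrite // metric_sym.
  apply: (le_trans (x_le_y n)).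
  (* The bound for [y] at n is the bound for [x] at n+1, which closes the induction. *)
  by have -> : n.+1%:R + 2 = n%:R + 3 :> R by rewrite -natr1; ring.
split=> [n|]; first by split; [|apply: y_le_x].
split=> k n hn.
  by apply: (le_trans (x_le n)); rewrite -natrM; exact: div_rate hn.
apply: (le_trans (y_le_x n (x_le n))).
by rewrite -natrM; exact: div_rate hn.
Qed.
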